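(* Let $\mathcal{D}$ be a convex set of real symmetric $N\times N$ matrices containing at least one positive definite matrix. Let $X_*$ be an optimizer of the problem $$\min_X\; -\log(|X|)\quad\text{s.t.}\quad X\in\mathcal{D},\; X\succeq 0,$$ and let $X_f$ be a feasible solution of the same problem (i.e. $X_f\in\mathcal{D}$, $X_f\succeq 0$). If $\epsilon$ is a (finite) real number such that $$\epsilon \;\geq\; \log(|X_*|)-\log(|X_f|)\;\geq\; 0,$$ then $$\|X_*-X_f\|_F^2\;\leq\;\|X_f\|_2^2\left(\frac{\sqrt[3]{1-e^{-\epsilon}}}{1-\sqrt[3]{1-e^{-\epsilon}}}\right)^2 .$$
   Context: $|X|$ denotes the determinant of $X$; $X\succeq 0$ (resp. $X\succ 0$) means $X$ is positive semidefinite (resp. positive definite). $\|\cdot\|_F$ is the Frobenius norm and $\|\cdot\|_2$ is the spectral (operator) norm. The convention $-\log 0=+\infty$ is used, so that an optimizer $X_*$ is positive definite, and finiteness of $\epsilon$ means that $X_f$ is positive definite as well. *)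

(* Defs.v *)
From HB Require Import structures.
From mathcomp Require Import all_boot all_order all_algebra.
From mathcomp Require Import all_classical all_reals all_analysis.

Set Implicit Arguments.
Unset Strict Implicit.
Unset Printing Implicit Defensive.

Import Order.TTheory GRing.Theory Num.Theory.

Local Open Scope classical_set_scope.
Local Open Scope ring_scope.

Definition psd (R : realType) (N : nat) (X : 'M[R]_N) : Prop :=
  X \is symmetricmx /\ forall v : 'cV[R]_N, 0 <= (v^T *m X *m v) 0 0.

Definition pd (R : realType) (N : nat) (X : 'M[R]_N) : Prop :=
  X \is symmetricmx /\
  forall v : 'cV[R]_N, v != 0 -> 0 < (v^T *m X *m v) 0 0.

(* The norm that the library puts on matrices is the maximum norm, so the
   Frobenius norm (the Euclidean norm on column vectors) and the spectral norm
   are defined here. *)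
Definition frobenius_norm (R : realType) (m n : nat) (A : 'M[R]_(m, n)) : R :=
  Num.sqrt (\sum_(i < m) \sum_(j < n) A i j ^+ 2).

(* The closed unit ball, rather than the unit sphere, keeps the set nonempty
   when n = 0. *)
Definition spectral_norm (R : realType) (m n : nat) (A : 'M[R]_(m, n)) : R :=
  sup [set frobenius_norm (A *m v) | v in
         [set v : 'cV[R]_n | frobenius_norm v <= 1]].

Definition feasible (R : realType) (N : nat) (D : set 'M[R]_N) : set 'M[R]_N :=
  [set X | D X /\ psd X].

(* lne 0 = -oo, so the objective is +oo at singular matrices. *)
Definition neg_log_det (R : realType) (N : nat) (X : 'M[R]_N) : \bar R :=
  (- lne (\det X)%:E)%E.

Definition optimizer (R : realType) (N : nat) (D : set 'M[R]_N)
    (X : 'M[R]_N) : Prop :=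
  feasible D X /\
  forall Y : 'M[R]_N, feasible D Y -> (neg_log_det X <= neg_log_det Y)%E.

(* Main.v *)
(* Write X_f = Q^T Q and X_* = Q^T diag(m) Q (simultaneous diagonalization), so
   that log|X_*| - log|X_f| = sum_i log m_i. Optimality of X_* along the segment
   to X_f gives sum_i (1 / m_i - 1) <= 0, hence sum_i h(m_i - 1) <= eps for
   h(u) = log(1 + u) - 1 + 1 / (1 + u). With r^2 = sum_i (m_i - 1)^2, the bound
   h(s r) >= s^2 h(r) for |s| <= 1 reduces this to a single eigenvalue:
   h(r) <= eps. In terms of d = r / (1 + r) it reads
   exp(-eps) <= (1 - d) exp d <= (1 - d) (1 + d + d^2) = 1 - d^3, so that
   r = d / (1 - d) is bounded. Finally
   |X_* - X_f|_F = |Q^T diag(m - 1) Q|_F <= |Q^T Q|_2 r. *)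

Require Import Defs.
From HB Require Import structures.
From mathcomp Require Import all_boot all_order all_algebra.
From mathcomp Require Import all_classical all_reals all_analysis.
From mathcomp Require Import ring lra complex.

Set Implicit Arguments.
Unset Strict Implicit.
Unset Printing Implicit Defensive.

Import Order.TTheory GRing.Theory Num.Theory.
Import numFieldNormedType.Exports.

Local Open Scope classical_set_scope.
Local Open Scope ring_scope.

(** * Simultaneous diagonalization of a symmetric and a positive definite form *)

Lemma symmetricmxP (R : realType) n (A : 'M[R]_n) :
  reflect (A^T = A) (A \is symmetricmx).
Proof.
apply: (iffP (is_hermitianmxP _ _ _)) => [{2}->|AT].
  by rewrite expr0 scale1r map_mx_id.
by rewrite expr0 scale1r map_mx_id.
Qed.

Lemma pd_unitmx (R : realType) n (B : 'M[R]_n) : pd B -> B \in unitmx.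
Proof.
move=> [/symmetricmxP BT Bpos]; apply/negPn/negP => Bnu.
have /det0P[v v0 vB] : \det B == 0 by rewrite unitmxE unitfE negbK in Bnu.
have := Bpos v^T; rewrite -trmx0 (inj_eq (can_inj (@trmxK _ _ _))) => /(_ v0).
by rewrite trmxK vB mul0mx mxE ltxx.
Qed.

(* The left kernel of a complex pencil [A - z B], split into real and imaginary
   parts [a + i b] and [x + i y]. *)
Lemma real_pencil_eigen (R : realType) n (A B : 'M[R]_n.+1) :
  B \in unitmx -> exists (a b : 'rV[R]_n.+1) (x y : R),
  [/\ (a != 0) || (b != 0),
      a *m A = x *: (a *m B) - y *: (b *m B) &
      b *m A = x *: (b *m B) + y *: (a *m B)].
Proof.
move=> Bu; pose f (C : 'M[R]_n.+1) := map_mx (real_complex R) C.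
have fM (C D : 'M[R]_n.+1) : f (C *m D) = f C *m f D by exact: map_mxM.
have [|z] := closed_rootP (char_poly (f (invmx B *m A))) _.
  by rewrite size_char_poly.
rewrite -eigenvalue_root_char => /eigenvalueP[u uz u0].
(* Moving [invmx B] from the matrix to the vector turns the eigenvector equation of [invmx B *m A]
   into the pencil equation w A = z w B. *)
pose w := u *m f (invmx B).
have wB : w *m f B = u.
  by rewrite -mulmxA -fM mulVmx// /f map_mx1 mulmx1.
have wA : w *m f A = z *: (w *m f B).
  by rewrite wB -uz -mulmxA -fM.
clearbody w; pose re := map_mx (@complex.Re R : R[i] -> R) w.
pose im := map_mx (@complex.Im R : R[i] -> R) w.
have ReM (C : 'M[R]_n.+1) j : (complex.Re ((w *m f C) 0 j) = (re *m C) 0 j)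
   /\ (complex.Im ((w *m f C) 0 j) = (im *m C) 0 j).
  rewrite !mxE; elim/big_rec3: _ => //= i x1 x2 x3 _ [<- <-].
  rewrite !mxE; case: x3 => c d; case: (w 0 i) => e g /=.
  by split; ring.
exists re, im, (complex.Re z), (complex.Im z); split.
- apply: contraT; rewrite negb_or !negbK => /andP[/eqP re0 /eqP im0].
  case/eqP: u0; rewrite -wB; apply/rowP => j; apply/eqP.
  have [h1 h2] := ReM B j; rewrite eq_complex h1 h2 re0 im0 !mul0mx !mxE.
  by rewrite !eqxx.
- apply/rowP => j; have [<- _] := ReM A j; have [h1 h2] := ReM B j.
  have -> : (complex.Re z *: (re *m B) - complex.Im z *: (im *m B)) 0 j =
    complex.Re z * (re *m B) 0 j - complex.Im z * (im *m B) 0 j by rewrite !mxE.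
  rewrite -h1 -h2 wA [in LHS]mxE; case: z ((w *m f B) 0 j) {uz wA h1 h2}.
  by move=> e g [c d].
- apply/rowP => j; have [_ <-] := ReM A j; have [h1 h2] := ReM B j.
  have -> : (complex.Re z *: (im *m B) + complex.Im z *: (re *m B)) 0 j =
    complex.Re z * (im *m B) 0 j + complex.Im z * (re *m B) 0 j by rewrite !mxE.
  rewrite -h1 -h2 wA [in LHS]mxE; case: z ((w *m f B) 0 j) {uz wA h1 h2}.
  by move=> e g [c d] /=; rewrite addrC.
Qed.

(** Pairing the equation for a with b and that for b with a, symmetry of A and B leaves y (a B a^T +
    b B b^T) = 0. The bracket is positive, so y = 0, and whichever of a, b is nonzero is a real
    eigenvector, then rescaled to B-norm 1. *)
Lemma gen_eigenvector (R : realType) n (A B : 'M[R]_n.+1) :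
  A^T = A -> pd B -> exists (v : 'cV[R]_n.+1) (x : R),
  (v^T *m B *m v) 0 0 = 1 /\ A *m v = x *: (B *m v).
Proof.
move=> AT pdB; have [/symmetricmxP BT Bpos] := pdB.
have [a [b [x [y [ab aA bA]]]]] := real_pencil_eigen A (pd_unitmx pdB).
have B_ge0 (u : 'rV[R]_n.+1) : 0 <= (u *m B *m u^T) 0 0 ?= iff (u == 0).
  have [->|u0] := eqVneq u 0; first by rewrite !mul0mx mxE; split; rewrite ?lexx ?eqxx.
  have := Bpos u^T; rewrite -trmx0 (inj_eq (can_inj (@trmxK _ _ _))) trmxK.
  by move=> /(_ u0) u_gt0; split; [exact: ltW | rewrite lt_eqF].
have y0 : y = 0.
  have sym (M : 'M[R]_n.+1) : M^T = M -> (a *m M *m b^T) 0 0 = (b *m M *m a^T) 0 0.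
    by move=> MT; rewrite -[a *m M *m b^T]trmxK mxE !trmx_mul trmxK MT mulmxA.
  have aAb : (a *m A *m b^T) 0 0 = x * (a *m B *m b^T) 0 0 - y * (b *m B *m b^T) 0 0.
    by rewrite aA mulmxBl -!scalemxAl !mxE.
  have bAa : (b *m A *m a^T) 0 0 = x * (b *m B *m a^T) 0 0 + y * (a *m B *m a^T) 0 0.
    by rewrite bA mulmxDl -!scalemxAl !mxE.
  move: (sym A AT); rewrite aAb bAa (sym B BT) => /addrI/esym/eqP.
  rewrite -subr_eq0 opprK -mulrDr mulf_eq0 => /orP[/eqP//|].
  rewrite paddr_eq0 ?(B_ge0 _).1// ![_ 0 0 == 0]eq_sym !(B_ge0 _).2.
  by case/andP => a0 b0; move: ab; rewrite a0 b0.
have [u u0 uA] : exists2 u : 'rV[R]_n.+1, u != 0 & u *m A = x *: (u *m B).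
  rewrite y0 !scale0r ?subr0 ?addr0 in aA bA.
  by case/orP: ab => [a0|b0]; [exists a | exists b].
have uB : 0 < (u *m B *m u^T) 0 0.
  by rewrite lt_neqAle (B_ge0 u).1 (B_ge0 u).2 u0.
pose c := Num.sqrt ((u *m B *m u^T) 0 0).
exists (c^-1 *: u^T), x; split.
  have -> : (c^-1 *: u^T)^T = c^-1 *: u by apply/matrixP => i j; rewrite !mxE.
  rewrite -!scalemxAl -scalemxAr scalerA -expr2 mxE exprVn sqr_sqrtr ?ltW//.
  by rewrite mulVf// gt_eqF.
rewrite -!scalemxAr [RHS]scalerA mulrC -scalerA; congr (_ *: _); apply: trmx_inj.
by rewrite linearZ /= !trmx_mul trmxK AT BT.
Qed.

Lemma orthogonal_complement (F : fieldType) n (u : 'rV[F]_n.+1) : u != 0 ->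
  exists C : 'M[F]_(n, n.+1), row_free C /\ C *m u^T = 0.
Proof.
move=> u0; have : \rank (kermx u^T) = n.
  by rewrite mxrank_ker mxrank_tr rank_rV u0 subn1.
(* The number of rows of [row_base] is literally a rank; a variable m in its place can be
   substituted away in the dependent type. *)
suff H m : \rank (kermx u^T) = m ->
    exists C : 'M[F]_(m, n.+1), row_free C /\ C *m u^T = 0 by exact: H.
move=> <-; exists (row_base (kermx u^T)).
split; first exact: row_base_free.
by apply/sub_kermxP; rewrite eq_row_base.
Qed.

(** Induction on the dimension: both forms are restricted to the B-orthogonal complement of a
    generalized eigenvector v, spanned by the rows of C. The mixed blocks vanish for B by the choice
    of C, hence for A because v^T A = x v^T B. *)
Lemma simultaneous_diag (R : realType) n (A B : 'M[R]_n) :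
  A^T = A -> pd B -> exists (P : 'M[R]_n) (d : 'rV[R]_n),
  P^T *m B *m P = 1%:M /\ P^T *m A *m P = diag_mx d.
Proof.
elim: n A B => [|n IHn] A B AT pdB.
  by exists 0, 0; split; apply/matrixP => -[].
have [/symmetricmxP BT Bpos] := pdB.
have [v [x [vBv Av]]] := gen_eigenvector AT pdB.
have vTA : v^T *m A = x *: (v^T *m B).
  by rewrite -AT -BT -!trmx_mul Av linearZ.
have [C [Cfree CBv]] : exists C : 'M[R]_(n, n.+1), row_free C /\ C *m (v^T *m B)^T = 0.
  apply: orthogonal_complement; apply/eqP => vB0.
  by move/eqP: vBv; rewrite vB0 mul0mx mxE eq_sym oner_eq0.
rewrite trmx_mul trmxK BT in CBv.
have vBC : v^T *m B *m C^T = 0.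
  by apply: trmx_inj; rewrite !trmx_mul !trmxK BT CBv trmx0.
have [||P2 [d [PB PA]]] := IHn (C *m A *m C^T) (C *m B *m C^T).
- by rewrite !trmx_mul !trmxK AT mulmxA.
- split; first by apply/symmetricmxP; rewrite !trmx_mul !trmxK BT mulmxA.
  move=> w w0; have -> : w^T *m (C *m B *m C^T) *m w = (C^T *m w)^T *m B *m (C^T *m w).
    by rewrite trmx_mul trmxK !mulmxA.
  apply: Bpos; apply: contra_neq w0 => Cw; apply: trmx_inj.
  apply: (row_free_inj Cfree); rewrite trmx0 mul0mx; apply: trmx_inj.
  by rewrite trmx_mul trmxK Cw trmx0.
pose P : 'M[R]_(1 + n) := row_mx v (C^T *m P2).
have PTMP (M : 'M[R]_(1 + n)) : P^T *m M *m P =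
    block_mx (v^T *m M *m v) (v^T *m M *m C^T *m P2)
             (P2^T *m (C *m (M *m v))) (P2^T *m (C *m M *m C^T) *m P2).
  by rewrite tr_row_mx mul_col_mx mul_col_row trmx_mul trmxK !mulmxA.
exists P, (row_mx x%:M d); split; rewrite PTMP.
  rewrite vBC CBv PB !mul0mx mulmx0 [v^T *m B *m v]mx11_scalar vBv.
  by rewrite -(@scalar_mx_block R 1 n).
rewrite vTA Av -!scalemxAl vBC -scalemxAr CBv PA scaler0 !mul0mx mulmx0.
rewrite [v^T *m B *m v]mx11_scalar vBv scalemx1.
apply: etrans (esym (diag_mx_row (x%:M : 'rV_1) d)); congr block_mx;
  last by rewrite scaler0.
by apply/matrixP => i j; rewrite !mxE !ord1.
Qed.

(** * One-variable inequalities for exp and log *)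

Lemma ge0_derive_le0r (R : realType) (f df : R -> R) (r : R) :
  0 <= r ->
  (forall x, 0 <= x -> x <= r -> is_derive x 1 f (df x)) ->
  (forall x, 0 <= x -> x <= r -> 0 <= df x) ->
  f 0 <= f r.
Proof.
move=> r0 fd df0.
have cf : {within `[0, r], continuous f}.
  apply: (@derivable_within_continuous R R f `[0, r]) => x.
  by rewrite in_itv /= => /andP[x0 xr]; have [] := fd x x0 xr.
have fd' (x : R) : x \in `]0, r[ -> is_derive x 1 f (df x).
  by rewrite in_itv /= => /andP[x0 xr]; apply: fd; exact: ltW.
have [c] := MVT_segment r0 fd' cf.
rewrite in_itv /= => /andP[c0 cr] fE.
by rewrite -subr_ge0 fE subr0 mulr_ge0// df0.
Qed.

(** The function (1 + x + x^2) exp(-x) equals 1 at 0 and has derivative x (1 - x) exp(-x), which is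
    nonnegative on [0, 1]. *)
Lemma expR_le_quadratic (R : realType) (d : R) :
  0 <= d -> d <= 1 -> expR d <= 1 + d + d ^+ 2.
Proof.
move=> d0 d1; pose g (x : R) := (1 + x + x ^+ 2) * expR (- x).
have : g 0 <= g d.
  apply: (@ge0_derive_le0r _ g (fun x => x * (1 - x) * expR (- x))) => // x x0 xd.
    apply: is_derive_eq.
    rewrite /GRing.scale /=. ring.
  by rewrite !mulr_ge0 ?expR_ge0// subr_ge0 (le_trans xd).
by rewrite /g oppr0 expR0 expr0n /= !addr0 mulr1 expRN ler_pdivlMr ?expR_gt0// mul1r.
Qed.

Lemma is_derive_log_gap (R : realType) (u : R) : 0 < 1 + u ->
  is_derive u 1 (fun v : R => ln (1 + v) - 1 + (1 + v)^-1) (u / (1 + u) ^+ 2).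
Proof.
move=> u1; have D1 : is_derive u 1 (fun v : R => 1 + v) 1.
  by rewrite -[X in is_derive _ _ _ X]add0r; exact: is_deriveD.
have Dl : is_derive u 1 (fun v : R => ln (1 + v)) ((1 + u)^-1 * 1).
  exact: (@is_derive1_comp _ (@ln R) (fun v : R => 1 + v) u _ _ (is_derive1_ln u1) D1).
have Di : is_derive u 1 (fun v : R => (1 + v)^-1) (- (1 + u) ^- 2 * 1).
  by apply: is_deriveV; rewrite gt_eqF.
apply: is_derive_eq; field; by rewrite gt_eqF.
Qed.

(* For [f r = ln (1 + r) - 1 + (1 + r)^-1] one has [f' r = r / (1 + r) ^+ 2],
   so the derivative in [r] of [f (s * r) - s ^+ 2 * f r] is
   [s ^+ 2 * r * ((1 + s * r) ^- 2 - (1 + r) ^- 2) >= 0]. *)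
Lemma log_gap_quadratic (R : realType) (s r : R) :
  `|s| <= 1 -> 0 <= r -> 0 < 1 + s * r ->
  s ^+ 2 * (ln (1 + r) - 1 + (1 + r)^-1) <=
  ln (1 + s * r) - 1 + (1 + s * r)^-1.
Proof.
rewrite ler_norml => /andP[s1 s2] r0 sr.
pose f (u : R) : R := ln (1 + u) - 1 + (1 + u)^-1.
pose g (x : R) : R := f (s * x) - s ^+ 2 * f x.
suff : g 0 <= g r.
  by rewrite /g mulr0 /f addr0 ln1 invr1 add0r addNr mulr0 subr0 subr_ge0.
have pos x : 0 <= x -> x <= r -> 0 < 1 + s * x.
  move=> x0 xr; have [s0|s0] := leP 0 s; first by rewrite ltr_wpDr// mulr_ge0.
  by apply: (lt_le_trans sr); rewrite lerD2l ler_wnM2l// ltW.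
apply: (@ge0_derive_le0r _ g
  (fun x => s ^+ 2 * x * ((1 + s * x) ^- 2 - (1 + x) ^- 2))) => // x x0 xr.
  have sx := pos x x0 xr.
  have x1 : 0 < 1 + x by rewrite ltr_wpDr.
  have Ds : is_derive x 1 (fun y : R => s * y) s.
    by apply: is_derive_eq; rewrite /GRing.scale /=; ring.
  have Df := is_derive_log_gap x1.
  have Dfs : is_derive x 1 (fun y : R => f (s * y)) (s * x / (1 + s * x) ^+ 2 * s).
    exact: (@is_derive1_comp _ f (fun y : R => s * y) x _ _ (is_derive_log_gap sx) Ds).
  have Dg : is_derive x 1 g
      (s * x / (1 + s * x) ^+ 2 * s - s ^+ 2 * (x / (1 + x) ^+ 2)).
    exact: is_deriveB Dfs (is_deriveZ _ Df).
  by apply: is_derive_eq; field; rewrite !gt_eqF.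
have sx := pos x x0 xr; have x1 : 0 < 1 + x by rewrite ltr_wpDr.
apply: mulr_ge0; first by rewrite mulr_ge0 ?sqr_ge0.
rewrite subr_ge0 lef_pV2 ?posrE ?exprn_gt0//.
by rewrite lerXn2r ?nnegrE ?(ltW sx) ?(ltW x1)// lerD2l ler_piMl.
Qed.

(** * Frobenius and spectral norms *)

Lemma frobenius_norm_ge0 (R : realType) m n (A : 'M[R]_(m, n)) :
  0 <= frobenius_norm A.
Proof. exact: sqrtr_ge0. Qed.

Lemma sqr_frobenius_norm (R : realType) m n (A : 'M[R]_(m, n)) :
  frobenius_norm A ^+ 2 = \sum_i \sum_j A i j ^+ 2.
Proof.
by rewrite sqr_sqrtr// sumr_ge0// => i _; rewrite sumr_ge0// => j _; rewrite sqr_ge0.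
Qed.

Lemma frobenius_norm_tr (R : realType) m n (A : 'M[R]_(m, n)) :
  frobenius_norm A^T = frobenius_norm A.
Proof.
congr Num.sqrt; rewrite exchange_big; apply: eq_bigr => i _.
by apply: eq_bigr => j _; rewrite mxE.
Qed.

Lemma sqr_frobenius_norm_col (R : realType) m n (A : 'M[R]_(m, n)) :
  frobenius_norm A ^+ 2 = \sum_j frobenius_norm (col j A) ^+ 2.
Proof.
rewrite sqr_frobenius_norm exchange_big; apply: eq_bigr => j _.
by rewrite sqr_frobenius_norm; apply: eq_bigr => i _; rewrite big_ord1 mxE.
Qed.

Lemma sqr_frobenius_norm_cV (R : realType) n (v : 'cV[R]_n) :
  frobenius_norm v ^+ 2 = (v^T *m v) 0 0.
Proof.
rewrite sqr_frobenius_norm mxE; apply: eq_bigr => i _.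
by rewrite big_ord1 mxE expr2.
Qed.

Lemma frobenius_normZ (R : realType) m n (a : R) (A : 'M[R]_(m, n)) :
  frobenius_norm (a *: A) = `|a| * frobenius_norm A.
Proof.
apply/eqP; rewrite -(@eqrXn2 _ 2) ?mulr_ge0 ?frobenius_norm_ge0//.
rewrite exprMn real_normK ?num_real// !sqr_frobenius_norm mulr_sumr; apply/eqP.
apply: eq_bigr => i _; rewrite mulr_sumr; apply: eq_bigr => j _.
by rewrite mxE exprMn.
Qed.

(** Lagrange's identity: the double sum of (x_i y_j - x_j y_i)^2 is twice the difference of the two
    sides. *)
Lemma cauchy_schwarz_sum (R : realFieldType) (I : finType) (x y : I -> R) :
  (\sum_i x i * y i) ^+ 2 <= (\sum_i x i ^+ 2) * (\sum_i y i ^+ 2).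
Proof.
have : 0 <= \sum_i \sum_j (x i * y j - x j * y i) ^+ 2.
  by rewrite sumr_ge0// => i _; rewrite sumr_ge0// => j _; rewrite sqr_ge0.
have -> : \sum_i \sum_j (x i * y j - x j * y i) ^+ 2 =
   ((\sum_i x i ^+ 2) * (\sum_i y i ^+ 2) - (\sum_i x i * y i) ^+ 2) *+ 2.
  rewrite mulr2n {1}[X in X - _]mulrC expr2 !big_distrlr /= -!sumrB -big_split.
  apply: eq_bigr => i _; rewrite -!sumrB -big_split /=.
  by apply: eq_bigr => j _ /=; ring.
by rewrite pmulrn_lge0// subr_ge0.
Qed.

Lemma cauchy_schwarz_cV (R : realType) n (x y : 'cV[R]_n) :
  (x^T *m y) 0 0 <= frobenius_norm x * frobenius_norm y.
Proof.
have [x0|x0] := leP 0 ((x^T *m y) 0 0); last first.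
  by rewrite (le_trans (ltW x0))// mulr_ge0 ?frobenius_norm_ge0.
rewrite -(@ler_pXn2r _ 2) ?nnegrE ?mulr_ge0 ?frobenius_norm_ge0//.
rewrite exprMn !sqr_frobenius_norm mxE.
under eq_bigr do rewrite mxE.
under [X in _ <= X * _]eq_bigr do rewrite big_ord1.
under [X in _ <= _ * X]eq_bigr do rewrite big_ord1.
exact: cauchy_schwarz_sum.
Qed.

Lemma frobenius_norm_mulmx_cV (R : realType) m n (A : 'M[R]_(m, n)) (v : 'cV[R]_n) :
  frobenius_norm (A *m v) <= frobenius_norm A * frobenius_norm v.
Proof.
rewrite -(@ler_pXn2r _ 2) ?nnegrE ?mulr_ge0 ?frobenius_norm_ge0//.
rewrite exprMn !sqr_frobenius_norm mulr_suml ler_sum// => i _.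
rewrite big_ord1 mxE; under [X in _ <= _ * X]eq_bigr do rewrite big_ord1.
exact: cauchy_schwarz_sum.
Qed.

(** The Frobenius norm of A bounds the set under the [sup], so the [sup] is a true upper bound on
    the unit ball; a general v is rescaled into it. *)
Lemma spectral_normP (R : realType) m n (A : 'M[R]_(m, n)) (v : 'cV[R]_n) :
  frobenius_norm (A *m v) <= spectral_norm A * frobenius_norm v.
Proof.
have unit (w : 'cV[R]_n) : frobenius_norm w <= 1 ->
    frobenius_norm (A *m w) <= spectral_norm A.
  move=> w1; apply: ub_le_sup; last by exists w.
  exists (frobenius_norm A) => _ [z z1 <-].
  apply: (le_trans (frobenius_norm_mulmx_cV A z)).
  by rewrite ler_piMr ?frobenius_norm_ge0.
have [v0|v0] := eqVneq (frobenius_norm v) 0.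
  by have := frobenius_norm_mulmx_cV A v; rewrite v0 !mulr0.
have vp : 0 < frobenius_norm v by rewrite lt_neqAle eq_sym v0 frobenius_norm_ge0.
have := unit ((frobenius_norm v)^-1 *: v).
rewrite -scalemxAr !frobenius_normZ gtr0_norm ?invr_gt0// mulVf// lexx.
by move=> /(_ isT); rewrite mulrC ler_pdivrMr.
Qed.

Lemma spectral_norm_ge0 (R : realType) m n (A : 'M[R]_(m, n)) :
  0 <= spectral_norm A.
Proof.
apply: ub_le_sup; last first.
  exists 0.
    by rewrite -[0](scale0r (0 : 'cV[R]_n)) /= frobenius_normZ normr0 mul0r.
  by rewrite mulmx0 -[0 in LHS](scale0r (0 : 'cV[R]_m)) frobenius_normZ normr0 mul0r.
exists (frobenius_norm A) => _ [z z1 <-].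
apply: (le_trans (frobenius_norm_mulmx_cV A z)).
by rewrite ler_piMr ?frobenius_norm_ge0.
Qed.

(* The operator norm of [Q^T] satisfies [|Q^T|^2 = |Q^T *m Q|]. *)
Lemma frobenius_norm_gram_cV (R : realType) n (Q : 'M[R]_n) (y : 'cV[R]_n) :
  frobenius_norm (Q^T *m y) ^+ 2 <= spectral_norm (Q^T *m Q) * frobenius_norm y ^+ 2.
Proof.
set s := spectral_norm _; set x := Q^T *m y.
have s0 : 0 <= s by exact: spectral_norm_ge0.
have Qx : frobenius_norm (Q *m x) ^+ 2 <= s * frobenius_norm x ^+ 2.
  rewrite sqr_frobenius_norm_cV trmx_mul -mulmxA [Q^T *m _]mulmxA.
  apply: (le_trans (cauchy_schwarz_cV _ _)).
  rewrite expr2 mulrCA ler_wpM2l ?frobenius_norm_ge0//.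
  exact: spectral_normP.
have xx : frobenius_norm x ^+ 2 <= frobenius_norm y * frobenius_norm (Q *m x).
  by rewrite sqr_frobenius_norm_cV {1}/x trmx_mul trmxK -mulmxA cauchy_schwarz_cV.
set a := frobenius_norm x in Qx xx *.
have a0 : 0 <= a by exact: frobenius_norm_ge0.
(* [xx] squared and [Qx] together give a^4 <= s |y|^2 a^2, from which the factor a^2 is
   cancelled. *)
have [->|an0] := eqVneq a 0.
  by rewrite expr0n mulr_ge0 ?sqr_ge0.
have ap : 0 < a ^+ 2 by rewrite exprn_gt0// lt_neqAle eq_sym an0.
rewrite -(ler_pM2r ap) -expr2.
apply: (@le_trans _ _ ((frobenius_norm y * frobenius_norm (Q *m x)) ^+ 2)).
  by rewrite lerXn2r ?nnegrE ?mulr_ge0 ?frobenius_norm_ge0// ltW.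
by rewrite exprMn [leRHS]mulrAC [leRHS]mulrC ler_wpM2l ?sqr_ge0.
Qed.

Lemma frobenius_norm_gram (R : realType) n (Q : 'M[R]_n) (Y : 'M[R]_n) :
  frobenius_norm (Q^T *m Y) ^+ 2 <= spectral_norm (Q^T *m Q) * frobenius_norm Y ^+ 2.
Proof.
rewrite sqr_frobenius_norm_col [X in _ * X]sqr_frobenius_norm_col mulr_sumr.
by rewrite ler_sum// => j _; rewrite !colE -mulmxA frobenius_norm_gram_cV.
Qed.

(** The Gram bound is applied twice, to the left factor and, after transposing, to the right one;
    each use costs one factor |Q^T Q|_2. *)
Lemma frobenius_norm_congr_diag (R : realType) n (Q : 'M[R]_n) (e : 'rV[R]_n) :
  frobenius_norm (Q^T *m diag_mx e *m Q) ^+ 2 <=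
  spectral_norm (Q^T *m Q) ^+ 2 * \sum_i e 0 i ^+ 2.
Proof.
rewrite -mulmxA (le_trans (frobenius_norm_gram _ _))// expr2 -mulrA.
rewrite ler_wpM2l ?spectral_norm_ge0// -frobenius_norm_tr trmx_mul tr_diag_mx.
rewrite (le_trans (frobenius_norm_gram _ _))// ler_wpM2l ?spectral_norm_ge0//.
rewrite sqr_frobenius_norm ler_sum// => i _.
rewrite (bigD1 i)//= big1 ?addr0 => [|j ji]; first by rewrite mxE eqxx.
by rewrite mxE eq_sym (negbTE ji) mulr0n expr0n.
Qed.

(** * First-order optimality and the resulting eigenvalue bound *)

(** The sum is the derivative of the product at th = 0, where the product is 1. Instead of
    differentiating, each factor is bounded below by exp(th (a_i - 2 th a_i^2)), so the sum is at
    most 2 th times the sum of squares for every small th. *)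
Lemma sum_le0_of_prod_le1 (R : realType) n (a : 'I_n -> R) :
  (forall i, -1 < a i) ->
  (forall th, 0 < th -> th <= 2^-1 -> \prod_i (1 + th * a i) <= 1) ->
  \sum_i a i <= 0.
Proof.
move=> a_gt prod_le.
have bound th : 0 < th -> th <= 2^-1 -> \sum_i a i <= 2 * th * \sum_i a i ^+ 2.
  move=> th0 th2; rewrite -subr_le0 -(pmulr_rle0 _ th0) -expR_le1.
  apply: le_trans (prod_le _ th0 th2).
  rewrite mulr_sumr -sumrB mulr_sumr expR_sum; apply: ler_prod => i _.
  rewrite expR_ge0 /=; set z := 1 + th * a i; have ai := a_gt i.
  have z2 : 2^-1 <= z by rewrite /z; nra.
  have z0 : 0 < z by lra.
  (* This is ln z >= 1 - 1/z. The remaining comparison of exponents reduces to 2 - 1/z >= 0, which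
     is where th <= 1/2 enters, through z >= 1/2. *)
  apply: (@le_trans _ _ (expR (1 - z^-1))); last first.
    rewrite -opprB expRN -[leRHS]invrK lef_pV2 ?posrE ?invr_gt0 ?expR_gt0//.
    by rewrite (le_trans _ (expR_ge1Dx _))// addrC subrK.
  rewrite ler_expR -subr_ge0.
  have -> : 1 - z^-1 - th * (a i - 2 * th * a i ^+ 2) =
            (th * a i) ^+ 2 * (2 - z^-1).
    have -> : th * a i = z - 1 by rewrite /z addrAC subrr add0r.
    have -> : th * (a i - 2 * th * a i ^+ 2) = (th * a i) - 2 * (th * a i) ^+ 2 by ring.
    have -> : th * a i = z - 1 by rewrite /z addrAC subrr add0r.
    by field; rewrite gt_eqF.
  by rewrite mulr_ge0 ?sqr_ge0// subr_ge0 -[leRHS]invrK lef_pV2 ?posrE ?invr_gt0.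
rewrite leNgt; apply/negP => S0; set S := \sum_i a i in S0 bound.
set T := \sum_i a i ^+ 2 in bound.
have T0 : 0 <= T by rewrite sumr_ge0// => i _; rewrite sqr_ge0.
have den : 0 < 2 * T + 2 * S + 1 by lra.
(* This th is at most 1/2, and 2 th T < S because the denominator exceeds 2 T. *)
have := bound (S / (2 * T + 2 * S + 1)).
rewrite divr_gt0// ler_pdivrMr// => /(_ isT).
have -> : S <= 2^-1 * (2 * T + 2 * S + 1) by lra.
rewrite mulrA mulrAC ler_pdivlMr// => /(_ isT); nra.
Qed.

Lemma generalized_eigenvalue_bound (R : realType) n (m : 'I_n -> R) (eps : R) :
  (forall i, 0 < m i) -> \sum_i ((m i)^-1 - 1) <= 0 -> \sum_i ln (m i) <= eps ->
  \sum_i (m i - 1) ^+ 2 <=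
  ((1 - expR (- eps)) `^ (3%:R^-1) /
   (1 - (1 - expR (- eps)) `^ (3%:R^-1))) ^+ 2.
Proof.
move=> m0 sumV sumln; set t := _ `^ _; set S := \sum_i _.
have S0 : 0 <= S by rewrite sumr_ge0// => i _; rewrite sqr_ge0.
have [->|Sn0] := eqVneq S 0; first exact: sqr_ge0.
pose r := Num.sqrt S.
have rS : r ^+ 2 = S by rewrite sqr_sqrtr.
have r0 : 0 < r by rewrite sqrtr_gt0 lt_neqAle eq_sym Sn0.
have r1 : 0 < 1 + r by rewrite addr_gt0.
pose h := ln (1 + r) - 1 + (1 + r)^-1.
have h_le : h <= eps.
  (* The weights s_i^2 = (m_i - 1)^2 / r^2 sum to 1, so the left side is h; on the right [sumV]
     discards the second summand. *)
  have : \sum_i ((m i - 1) ^+ 2 / r ^+ 2 * h) <= \sum_i (ln (m i) + ((m i)^-1 - 1)).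
    apply: ler_sum => i _.
    have mE : 1 + (m i - 1) / r * r = m i by rewrite divfK ?gt_eqF// addrC subrK.
    have := @log_gap_quadratic R ((m i - 1) / r) r.
    rewrite mE expr_div_n -/h -addrA [-1 + _]addrC; apply; rewrite ?(ltW r0) ?m0//.
    rewrite normrM normfV (gtr0_norm r0) ler_pdivrMr// mul1r.
    rewrite -(@ler_pXn2r _ 2) ?nnegrE ?normr_ge0 ?(ltW r0)// real_normK ?num_real//.
    by rewrite rS /S (bigD1 i)//= lerDl sumr_ge0// => j _; rewrite sqr_ge0.
  rewrite -mulr_suml -mulr_suml -/S rS divff// mul1r big_split /= => hle.
  by rewrite (le_trans hle)// -[leRHS]addr0 lerD.
pose d := r / (1 + r).
have d0 : 0 <= d by rewrite divr_ge0// ltW.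
have d1 : d <= 1 by rewrite ler_pdivrMr// mul1r lerDr.
have d1E : 1 - d = (1 + r)^-1 by rewrite /d; field; rewrite gt_eqF.
(* Since 1 - d = 1 / (1 + r), one has -h = d + ln (1 - d), that is exp(-h) = (1 - d) exp d. *)
have d3 : d ^+ 3 <= 1 - expR (- eps).
  rewrite lerBrDl -lerBrDr.
  apply: (@le_trans _ _ (expR (- h))); first by rewrite ler_expR lerN2.
  have -> : - h = d - ln (1 + r) by rewrite /h -d1E; ring.
  rewrite expRB lnK ?posrE// -d1E.
  apply: (@le_trans _ _ ((1 + d + d ^+ 2) * (1 - d))).
    by rewrite ler_wpM2r ?subr_ge0// expR_le_quadratic.
  by rewrite le_eqVlt; apply/orP; left; apply/eqP; ring.
(* Nonnegativity of the radicand, inherited from d^3, makes t a genuine cube root in [t3]. *)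
have q0 : 0 <= 1 - expR (- eps) by rewrite (le_trans _ d3)// exprn_ge0.
have t0 : 0 <= t by exact: powR_ge0.
have t3 : t ^+ 3 = 1 - expR (- eps).
  by rewrite -powR_mulrn// -powRrM mulVf ?pnatr_eq0// powRr1.
(* Positivity of exp(-eps) keeps t below 1, so d <= t can be solved for r <= t / (1 - t). *)
have t1 : t < 1 by rewrite -(@expr_lt1 _ 3)// t3 gtrBl expR_gt0.
have dt : d <= t by rewrite -(@ler_pXn2r _ 3) ?nnegrE// t3.
rewrite -rS lerXn2r ?nnegrE ?(ltW r0)// ?divr_ge0 ?subr_ge0 ?(ltW t1)//.
rewrite ler_pdivlMr ?subr_gt0//.
by move: dt; rewrite /d ler_pdivrMr//; lra.
Qed.

(** * Definiteness, determinants and the feasible set *)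

(** If v^T X v = 0, the form at v - t X v is t^2 c - 2 t a with a = |X v|^2. Its nonnegativity for
    all t forces a = 0, so X v = 0 and v = 0. *)
Lemma psd_unitmx_pd (R : realType) n (X : 'M[R]_n) :
  psd X -> X \in unitmx -> pd X.
Proof.
move=> [/symmetricmxP XT Xge0] Xu; split; first exact/symmetricmxP.
move=> v v0; rewrite lt_neqAle Xge0 andbT eq_sym; apply: contra_neq v0 => vXv.
pose w := X *m v.
suff w0 : w = 0 by rewrite -[v](mulKmx Xu) -/w w0 mulmx0.
pose a := (w^T *m w) 0 0; pose c := (w^T *m X *m w) 0 0.
have a0 : 0 <= a by rewrite /a -sqr_frobenius_norm_cV sqr_ge0.
have c0 : 0 <= c by exact: Xge0.
have quad t : 0 <= t ^+ 2 * c - 2 * t * a.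
  have vX : v^T *m X = w^T by rewrite trmx_mul XT.
  have := Xge0 (v - t *: w).
  have -> : (v - t *: w)^T = v^T - t *: w^T.
    by apply/matrixP => i j; rewrite !mxE.
  have -> : (v^T - t *: w^T) *m X *m (v - t *: w) =
      v^T *m X *m v - t *: (w^T *m w) - t *: (w^T *m w) + t ^+ 2 *: (w^T *m X *m w).
    rewrite mulmxBl mulmxBr !mulmxBl -!scalemxAl -!scalemxAr scalerA -expr2.
    by rewrite vX -[w^T *m X *m v]mulmxA -/w opprB addrA addrAC.
  have -> : (v^T *m X *m v - t *: (w^T *m w) - t *: (w^T *m w)
      + t ^+ 2 *: (w^T *m X *m w)) 0 0 =
      (v^T *m X *m v) 0 0 - t * a - t * a + t ^+ 2 * c.
    by rewrite /a /c !mxE.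
  by rewrite vXv; lra.
have [a_gt0|] := ltP 0 a; last first.
  move=> a_le0; have /eqP : a = 0 by apply/le_anti; rewrite a0 a_le0.
  rewrite /a -sqr_frobenius_norm_cV sqr_frobenius_norm psumr_eq0 => [|i _]; last first.
    by rewrite sumr_ge0// => j _; rewrite sqr_ge0.
  move=> /allP h; apply/matrixP => i j; rewrite ord1 [RHS]mxE; apply/eqP.
  by have := h i (mem_index_enum _); rewrite /= big_ord1 sqrf_eq0.
(* The minimizer would be a / c; adding 1 covers c = 0 and still gives a negative value when a >
   0. *)
have := quad (a / (c + 1)).
have -> : (a / (c + 1)) ^+ 2 * c - 2 * (a / (c + 1)) * a =
  - (a ^+ 2 / (c + 1) ^+ 2) * (c + 2) by field; rewrite gt_eqF// ltr_wpDl.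
by rewrite mulNr oppr_ge0 leNgt mulr_gt0 ?divr_gt0 ?exprn_gt0 ?ltr_wpDl//.
Qed.

(** Diagonalizing X against itself gives P^T X P = 1, hence (det P)^2 det X = 1. *)
Lemma pd_det_gt0 (R : realType) n (X : 'M[R]_n) : pd X -> 0 < \det X.
Proof.
move=> pdX; have [/symmetricmxP XT _] := pdX.
have [P [d [PX _]]] := simultaneous_diag XT pdX.
have := congr1 determinant PX; rewrite !det_mulmx det_tr det1 mulrAC -expr2 => detPX.
have P0 : 0 < \det P ^+ 2.
  rewrite lt_neqAle sqr_ge0 andbT eq_sym; apply/eqP => P0.
  by move/eqP: detPX; rewrite P0 mul0r eq_sym oner_eq0.
by rewrite -(pmulr_rgt0 _ P0) detPX.
Qed.

Lemma optimizer_det_le (R : realType) N (D : set 'M[R]_N) (X Y : 'M[R]_N) :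
  optimizer D X -> feasible D Y -> 0 < \det Y -> \det Y <= \det X.
Proof.
move=> [_ optX] feasY Y0; have := optX Y feasY.
rewrite /neg_log_det leeN2 (lne_EFin Y0) /=.
(* If det X <= 0, its [lne] is -oo and cannot dominate the finite value at Y. *)
case: ifPn => [_|]; first by rewrite leeNy_eq.
by rewrite -ltNge => X0; rewrite lee_fin ler_ln.
Qed.

Lemma feasible_segment (R : realType) N (D : set 'M[R]_N) (X Y : 'M[R]_N) (th : R) :
  convex_set D -> feasible D X -> feasible D Y -> 0 <= th -> th <= 1 ->
  feasible D (th *: Y + (1 - th) *: X).
Proof.
move=> cD [DX [/symmetricmxP XT X0]] [DY [/symmetricmxP YT Y0]] th0 th1; split.
  by have := cD Y X (Itv01 th0 th1); rewrite !inE => /(_ DY DX).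
split.
  by apply/symmetricmxP; apply/matrixP => i j; rewrite !mxE -{1}XT -{1}YT !mxE.
move=> v; rewrite mulmxDr mulmxDl -!scalemxAr -!scalemxAl.
have -> : (th *: (v^T *m Y *m v) + (1 - th) *: (v^T *m X *m v)) 0 0 =
  th * (v^T *m Y *m v) 0 0 + (1 - th) * (v^T *m X *m v) 0 0 by rewrite !mxE.
by rewrite addr_ge0// mulr_ge0 ?subr_ge0.
Qed.

Theorem theorem4p3 (R : realType) (N : nat) (D : set 'M[R]_N)
    (hDsym : forall X : 'M[R]_N, D X -> X \is symmetricmx)
    (hDconv : convex_set D)
    (hDpd : exists X : 'M[R]_N, D X /\ pd X)
    (Xs Xf : 'M[R]_N) (hXs : optimizer D Xs) (hXf : feasible D Xf)
    (eps : R)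
    (hgap : (0 <= lne (\det Xs)%:E - lne (\det Xf)%:E)%E)
    (heps : (lne (\det Xs)%:E - lne (\det Xf)%:E <= eps%:E)%E) :
  frobenius_norm (Xs - Xf) ^+ 2 <=
  spectral_norm Xf ^+ 2 *
  ((1 - expR (- eps)) `^ (3%:R^-1) /
   (1 - (1 - expR (- eps)) `^ (3%:R^-1))) ^+ 2.
Proof.
have [Y [DY pdY]] := hDpd.
have feasY : feasible D Y.
  split=> //; have [YT Ypos] := pdY; split=> // v.
  have [->|v0] := eqVneq v 0; first by rewrite mulmx0 mxE.
  exact/ltW/Ypos.
(* The positive definite competitor has finite objective, hence so does the optimizer. *)
have Xs0 : 0 < \det Xs.
  have Y0 := pd_det_gt0 pdY; exact: lt_le_trans (optimizer_det_le hXs feasY Y0).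
(* Otherwise the gap would be +oo, exceeding the real number eps. *)
have Xf0 : 0 < \det Xf.
  rewrite ltNge; apply/negP => Xf0; move: heps.
  by rewrite (lne_EFin Xs0) /= Xf0.
have feasXs := hXs.1.
have [_ [/symmetricmxP XsT Xs_ge0]] := feasXs.
have pdXf : pd Xf.
  by apply: psd_unitmx_pd; [case: hXf | rewrite unitmxE unitfE gt_eqF].
(* [Xf] is the form normalized to the identity; the entries of d are the m_i of the overview. *)
have [P [d [PXf PXs]]] := simultaneous_diag XsT pdXf.
have Pu : P \in unitmx by have [] := mulmx1_unit PXf.
pose Q := invmx P.
have conj (M M' : 'M[R]_N) : P^T *m M *m P = M' -> M = Q^T *m M' *m Q.
  move=> <-; rewrite /Q trmx_inv -!mulmxA mulmxV// mulmx1 mulKmx//.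
  by rewrite unitmx_tr.
have XfE : Xf = Q^T *m Q by rewrite {1}(conj _ _ PXf) mulmx1.
have XsE : Xs = Q^T *m diag_mx d *m Q := conj _ _ PXs.
have Q0 : 0 < \det Q ^+ 2.
  by rewrite lt_neqAle sqr_ge0 andbT eq_sym sqrf_eq0 -unitfE -unitmxE unitmx_inv.
have det_congr (e : 'rV[R]_N) :
    \det (Q^T *m diag_mx e *m Q) = \det Q ^+ 2 * \prod_i e 0 i.
  by rewrite !det_mulmx det_tr det_diag mulrAC expr2.
have prod_d0 : 0 < \prod_i d 0 i by rewrite -(pmulr_rgt0 _ Q0) -det_congr -XsE.
(* Each entry is nonzero because the product is positive, and nonnegative as the value of the form
   [Xs] at column i of P. *)
have d0 i : 0 < d 0 i.
  rewrite lt_neqAle; apply/andP; split.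
    rewrite eq_sym; apply: contraTneq prod_d0 => di0.
    by rewrite (bigD1 i)//= di0 mul0r ltxx.
  have := Xs_ge0 (col i P); rewrite colE trmx_mul trmx_delta -!mulmxA -rowE.
  by rewrite !mulmxA -colE PXs !mxE eqxx mulr1n.
have detXf : \det Xf = \det Q ^+ 2 by rewrite XfE det_mulmx det_tr expr2.
have detXs : \det Xs = \det Q ^+ 2 * \prod_i d 0 i by rewrite {1}XsE det_congr.
have sumln : \sum_i ln (d 0 i) <= eps.
  move: heps; rewrite !lne_EFin// -EFinB lee_fin -ln_div ?posrE//.
  rewrite detXs detXf mulrAC divff ?gt_eqF// mul1r.
  suff -> : ln (\prod_i d 0 i) = \sum_i ln (d 0 i) by [].
  (* The induction also carries positivity of the partial products, which [lnM] requires. *)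
  apply: (@proj2 (0 < \prod_i d 0 i)).
  elim/big_rec2: _ => [|i y1 y2 _ [y2_gt0 <-]]; first by rewrite ln1.
  by rewrite mulr_gt0// lnM ?posrE.
have sumV : \sum_i ((d 0 i)^-1 - 1) <= 0.
  apply: sum_le0_of_prod_le1 => [i|th th0 th2].
    by rewrite ltrBrDr addNr invr_gt0.
  (* These are the diagonal entries of the segment point in the common coordinates. Dividing its
     determinant by that of [Xs] gives exactly the product of 1 + th (1/d_i - 1). *)
  pose e := (\row_i (th + (1 - th) * d 0 i)) : 'rV[R]_N.
  have XthE : th *: Xf + (1 - th) *: Xs = Q^T *m diag_mx e *m Q.
    have -> : diag_mx e = th%:M + (1 - th) *: diag_mx d.
      apply/matrixP => i j; rewrite !mxE; case: (i == j); rewrite ?mulr1n// !mulr0n.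
      by rewrite mulr0 addr0.
    rewrite mulmxDr mulmxDl mul_mx_scalar -scalemxAr -!scalemxAl.
    by rewrite -XfE -XsE.
  have th1 : th <= 1 by lra.
  have e0 i : 0 < e 0 i by rewrite mxE ltr_wpDr// mulr_ge0 ?subr_ge0// ltW.
  have := optimizer_det_le hXs (feasible_segment hDconv feasXs hXf (ltW th0) th1).
  rewrite XthE det_congr detXs ler_pM2l// mulr_gt0 ?prodr_gt0// => /(_ isT) ed.
  have -> : \prod_i (1 + th * ((d 0 i)^-1 - 1)) = (\prod_i e 0 i) / \prod_i d 0 i.
    rewrite -prodf_div; apply: eq_bigr => i _; rewrite mxE.
    by field; rewrite gt_eqF.
  by rewrite ler_pdivrMr// mul1r.
have -> : Xs - Xf = Q^T *m diag_mx (\row_i (d 0 i - 1)) *m Q.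
  have -> : diag_mx (\row_i (d 0 i - 1)) = diag_mx d - 1%:M.
    by apply/matrixP => i j; rewrite !mxE mulrnBl.
  by rewrite mulmxBr mulmxBl mulmx1 -XfE -XsE.
apply: (le_trans (frobenius_norm_congr_diag _ _)); rewrite -XfE.
rewrite ler_wpM2l ?sqr_ge0//; under eq_bigr do rewrite mxE.
exact: generalized_eigenvalue_bound.
Qed.
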